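(* For every integer $n\ge 3$, there exists an integer $N$ such that every prime graph with at least $N$ vertices contains, as an induced subgraph, one of the following graphs or the complement of one of the following graphs: (1) the $1$-subdivision $K_{1,n}^{(1)}$ of $K_{1,n}$; (2) the line graph of $K_{2,n}$; (3) the thin spider with $n$ legs; (4) the half-graph $H_n$ of height $n$; (5) the graph $H'_{n,I}$; (6) the graph $H^*_n$; (7) a prime graph induced by a chain of length $n$.
   Context: All graphs are finite, simple and undirected. A set $X$ of vertices of a graph $G$ is homogeneous if $2\le |X|<|V(G)|$ and every vertex outside $X$ is either adjacent to all vertices in $X$ or adjacent to no vertex in $X$. A graph is prime if it has no homogeneous set. The graph $K_{1,n}^{(1)}$ is obtained from the star $K_{1,n}$ by subdividing every edge exactly once. The thin spider with $n$ legs is the graph on $2n$ vertices consisting of an independent set $\{a_1,\ldots,a_n\}$ and a clique $\{b_1,\ldots,b_n\}$ such that $a_i$ is adjacent to $b_j$ if and only if $i=j$. The half-graph $H_n$ of height $n$ is the bipartite graph on $2n$ vertices $a_1,\ldots,a_n,b_1,\ldots,b_n$ (with sides $\{a_1,\ldots,a_n\}$ and $\{b_1,\ldots,b_n\}$) such that $a_i$ is adjacent to $b_j$ if and only if $i\ge j$. The half split graph $H'_n$ of height $n$ is obtained from $H_n$ by making $\{b_1,\ldots,b_n\}$ a clique. The graph $H'_{n,I}$ is obtained from $H'_n$ by adding a new vertex whose neighbors are exactly $a_1,\ldots,a_n$. The graph $H^*_n$ is obtained from $H'_n$ by adding a new vertex whose only neighbor is $a_n$. A chain of length $n$ (where $n\ge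 2$) in a graph is a sequence $v_0,v_1,\ldots,v_n$ of distinct vertices such that for every $i>0$, $v_{i-1}$ is either the unique neighbor or the unique non-neighbor of $v_i$ in $\{v_0,v_1,\ldots,v_{i-1}\}$. A graph is induced by a chain if it is the subgraph induced on the vertex set of the chain. *)

(* Defs.v *)
From HB Require Import structures.
From mathcomp Require Import all_boot.
Set Implicit Arguments.
Unset Strict Implicit.
Unset Printing Implicit Defensive.

Record sgraph := SGraph {
  vertex :> finType;
  adj : rel vertex;
  adj_sym : symmetric adj;
  adj_irr : irreflexive adj
}.

(* The simple graph on T in which distinct x and y are adjacent as soon as
   e x y or e y x holds; so e may list each edge in one direction only. *)
Section GraphOf.
Variables (T : finType) (e : rel T).

Definition sym_adj : rel T := fun x y => (x != y) && (e x y || e y x).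

Lemma sym_adj_sym : symmetric sym_adj.
Proof. by move=> x y; rewrite /sym_adj eq_sym orbC. Qed.

Lemma sym_adj_irr : irreflexive sym_adj.
Proof. by move=> x; rewrite /sym_adj eqxx. Qed.

Definition graph_of : sgraph := SGraph sym_adj_sym sym_adj_irr.
End GraphOf.

Definition compl (G : sgraph) : sgraph := graph_of (fun x y : G => ~~ adj x y).

Definition induced (G : sgraph) (A : {set G}) : sgraph :=
  graph_of (fun x y : {x : G | x \in A} => adj (val x) (val y)).

Definition contains_induced (G H : sgraph) : Prop :=
  exists2 f : H -> G, injective f & forall x y, adj (f x) (f y) = adj x y.

Definition isomorphic (G H : sgraph) : Prop :=
  exists2 f : G -> H, bijective f & forall x y, adj (f x) (f y) = adj x y.

Definition homogeneous (G : sgraph) (X : {set G}) : Prop :=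
  2 <= #|X| < #|G| /\
  forall v : G, v \notin X ->
    (forall x, x \in X -> adj v x) \/ (forall x, x \in X -> ~~ adj v x).

Definition prime_graph (G : sgraph) : Prop :=
  forall X : {set G}, ~ homogeneous X.

Definition edges (G : sgraph) : {set {set G}} :=
  [set e | [exists x : G, exists y : G, adj x y && (e == [set x; y])]].

Definition edge (G : sgraph) : finType := {e : {set G} | e \in edges G}.

Definition line_graph (G : sgraph) : sgraph :=
  graph_of (fun e f : edge G => val e :&: val f != set0).

(* Every edge e of G becomes a new vertex inr e, adjacent to the ends of e. *)
Definition subdivision (G : sgraph) : sgraph :=
  graph_of (fun u v : G + edge G =>
    match u, v with inl x, inr e => x \in val e | _, _ => false end).

Definition complete_bipartite (m n : nat) : sgraph :=
  graph_of (fun u v : 'I_m + 'I_n =>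
    match u, v with inl _, inr _ => true | _, _ => false end).

(* In the next families, the vertices a_1, ..., a_n are inl 0, ..., inl (n-1)
   and b_1, ..., b_n are inr 0, ..., inr (n-1). *)
Definition thin_spider (n : nat) : sgraph :=
  graph_of (fun u v : 'I_n + 'I_n =>
    match u, v with
    | inl i, inr j => i == j
    | inr _, inr _ => true
    | _, _ => false
    end).

Definition half_graph (n : nat) : sgraph :=
  graph_of (fun u v : 'I_n + 'I_n =>
    match u, v with inl i, inr j => j <= i | _, _ => false end).

Definition make_clique (G : sgraph) (A : {set G}) : sgraph :=
  graph_of (fun x y : G => adj x y || (x \in A) && (y \in A)).

(* The new vertex is None; its neighbourhood is A. *)
Definition add_vertex (G : sgraph) (A : {set G}) : sgraph :=
  graph_of (fun u v : option G =>
    match u, v with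
    | Some x, Some y => adj x y
    | None, Some y => y \in A
    | _, _ => false
    end).

Definition half_split_graph (n : nat) : sgraph :=
  @make_clique (half_graph n) [set inr j | j : 'I_n].

Definition half_split_I (n : nat) : sgraph :=
  @add_vertex (half_split_graph n) [set inl i | i : 'I_n].

Definition half_split_star (n : nat) : sgraph :=
  @add_vertex (half_split_graph n) [set inl i | i : 'I_n & i.+1 == n].

Definition chain (G : sgraph) (n : nat) (v : 'I_n.+1 -> G) : Prop :=
  [/\ 2 <= n, injective v &
      forall i k : 'I_n.+1, i = k.+1 :> nat ->
        let before := [set v j | j : 'I_n.+1 & j < i] in
        [set u in before | adj (v i) u] = [set v k] \/
        [set u in before | ~~ adj (v i) u] = [set v k]].

Definition induced_by_chain (n : nat) (H : sgraph) : Prop :=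
  exists (G : sgraph) (v : 'I_n.+1 -> G),
    chain v /\ isomorphic H (induced [set v i | i : 'I_n.+1]).

Definition contains_or_compl (G H : sgraph) : Prop :=
  contains_induced G H \/ contains_induced G (compl H).

(* Main.v *)
Require Import Defs.
From mathcomp Require Import all_boot zify.

(** Proof idea.  In a prime graph every two vertices [x, y] are joined to every
    vertex [z] by a chain starting with [x, y], and a chain of length [n + 1] yields
    a prime chain of length [n]; so all chains may be assumed to have length at most [n].

    Since no two vertices are twins, a large prime graph contains vertices
    [s_1, ..., s_m, t_1, ..., t_m] where [t_i] separates [s_i] from all later [s_j].
    Ramsey's theorem then gives one of the wanted graphs, a long induced matching or its
    complement, or a half split graph.

    From the edges of a matching take chains to one common vertex [z] and make the
    array of these chains homogeneous by Ramsey's theorem.  Let [k] be the first column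
    such that the rows are not pairwise anticomplete up to column [k].  Either a vertex
    of column [k] is mixed on the other rows, which gives a subdivided star since the rows
    are connected, or column [k] and an earlier one are related by a half graph, a matching
    or a co-matching in such a way that one of the wanted graphs or a half split graph
    appears.  If there is no such [k], then the last column, which is the vertex [z]
    repeated, cannot be mixed on its rows.

    In a half split graph, ordered so that each vertex is complete or anticomplete to
    all later ones, take a chain from the last two vertices to the first one, and thin
    out the half split graph so that each vertex of the chain is uniform on either side.
    The first vertex of the chain that does not attach like a last vertex gives
    [half_split_I], [half_split_star] or the complement of the latter.

    Complements are handled by a bit [eps] that is added to all adjacencies. *)

Set Implicit Arguments.
Unset Strict Implicit.
Unset Printing Implicit Defensive.

Definition unavoidable (n : nat) (G : sgraph) : Prop :=
    contains_or_compl G (subdivision (complete_bipartite 1 n)) \/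
    contains_or_compl G (line_graph (complete_bipartite 2 n)) \/
    contains_or_compl G (thin_spider n) \/
    contains_or_compl G (half_graph n) \/
    contains_or_compl G (half_split_I n) \/
    contains_or_compl G (half_split_star n) \/
    (exists H : sgraph,
      [/\ prime_graph H, induced_by_chain n H & contains_or_compl G H]).

(** * Prime graphs induced by chains *)

(* The chain consists of [v 0, ..., v m.-1], so that its length is [m.-1]. *)
Definition is_chain (G : sgraph) (m : nat) (v : nat -> G) : Prop :=
  {in gtn m &, injective v} /\
  forall i j, j.+1 < i -> i < m -> adj (v i) (v j) = ~~ adj (v i) (v i.-1).

(** [P] stands for the indices of a candidate homogeneous set. Each chain vertex distinguishes its
    predecessor from all earlier vertices, which pushes [P] upwards to [n]. The condition on [v 0]
    then pulls 0 and 1 into [P], and pushing up once more gives everything. *)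
Lemma chain_closed (G : sgraph) (n : nat) (v : nat -> G) (P : pred nat) :
  2 < n -> is_chain n.+1 v -> adj (v 1) (v 0) != adj (v n) (v 0) ->
  (forall p q k, p <= n -> q <= n -> k <= n -> P p -> P q -> ~~ P k ->
     adj (v k) (v p) = adj (v k) (v q)) ->
  forall p q, p < q <= n -> P p -> P q -> forall k, k <= n -> P k.
Proof.
move=> n2 [_ ch] v10 unif.
have tail p q : p < q -> P p -> P q -> forall k, q <= k <= n -> P k.
  move=> pq Pp Pq; elim=> [|k IH] /andP[qk kn]; first by move: pq; rewrite ltnNge; lia.
  have [<-|qk'] : q = k.+1 \/ q <= k by lia.
    by [].
  have Pk : P k by apply: IH; lia.
  apply/negPn/negP => nP.
  have := ch k.+1 p ltac:(lia) ltac:(lia).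
  rewrite (unif p k k.+1) //=; [|lia..].
  by case: (adj _ _).
move=> p q /andP[pq qn] Pp Pq.
have Pn : P n by apply: (tail p q) => //; lia.
have chn j : j.+1 < n -> adj (v n) (v j) = adj (v n) (v 0).
  by move=> jn; rewrite (ch n j) ?(ch n 0) //; lia.
(* For the least [i] in [P]: if [i = 1], then [v 0] separates [v 1] from [v n]. If [i > 1], then
   [v 0] and [v i.-1] lie outside and do not separate [v i] from [v n]. But [v n] treats them alike
   and [v i] does not. *)
have P0 : P 0.
  apply/negPn/negP => nP0.
  have exP : exists i, P i by exists p.
  case: (ex_minnP exP) => i Pi mini.
  have ip := mini _ Pp.
  have [i0|[i1|i2]] : i = 0 \/ i = 1 \/ 1 < i by lia.
  - by rewrite i0 (negbTE nP0) in Pi.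
  - move: v10; rewrite i1 in Pi.
    by rewrite adj_sym (unif 1 n 0) // ?(adj_sym (v 0)) ?eqxx //; lia.
  have nPi : ~~ P i.-1 by apply/negP => /mini; lia.
  have := ch i 0 i2 ltac:(lia).
  rewrite adj_sym (unif i n 0) //; [|lia..].
  rewrite (adj_sym (v i)) (unif i n i.-1) //; [|lia..].
  rewrite !(adj_sym _ (v n)) (chn i.-1); last lia.
  by case: (adj _ _).
have P1 : P 1.
  apply/negPn/negP => nP1.
  move: v10; rewrite (unif 0 n 1) //; [|lia..].
  by rewrite adj_sym chn ?eqxx //; lia.
by case=> // k kn; apply: (tail 0 1) => //; lia.
Qed.

Lemma inducedE (G : sgraph) (A : {set G}) (x y : induced A) :
  adj x y = adj (val x) (val y).
Proof.
rewrite /= /sym_adj (adj_sym (val y)) orbb.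
by case: eqVneq => // ->; rewrite adj_irr.
Qed.

Lemma prime_chain (G : sgraph) (n : nat) (v : nat -> G) :
  2 < n -> is_chain n.+1 v -> adj (v 1) (v 0) != adj (v n) (v 0) ->
  unavoidable n G.
Proof.
move=> n2 ch v10; do 6 right.
set A := [set v i | i : 'I_n.+1].
exists (induced A); split; last first.
- left; exists val; first exact: val_inj.
  by move=> x y; rewrite inducedE.
- exists G, (fun i => v i); split; last first.
    by exists id => //; exists id.
  have [vinj chP] := ch.
  split; first lia.
    by move=> i j /vinj/val_inj; apply; rewrite inE ltn_ord.
  move=> i k ik; rewrite /=.
  (* [b = true] gives the unique neighbour clause of [chain], [b = false] the unique non-neighbour
     clause. *)
  have main (b : bool) : adj (v i) (v k) = b ->
     [set u in [set v j | j : 'I_n.+1 & j < i] | adj (v i) u == b] = [set v k].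
    move=> Eb; apply/setP => u; rewrite !inE; apply/andP/eqP.
      case=> /imsetP[j]; rewrite inE => ji -> /eqP Ej.
      have [-> //|jk] : j = k :> nat \/ j.+1 < i by lia.
      have := chP i j jk (ltn_ord i); have -> : i.-1 = k by rewrite ik.
      by rewrite Ej Eb; case: (b).
    by move=> ->; rewrite Eb eqxx; split=> //; apply: imset_f; rewrite inE ik.
  case Eb: (adj (v i) (v k)); [left|right]; rewrite -(main _ Eb).
    by apply/setP => u; rewrite !inE eqb_id.
  by apply/setP => u; rewrite !inE eqbF_neg.
move=> X [/andP[X2 XG] hom].
pose P k := [exists x in X, val x == v k].
have memv k : k <= n -> v k \in A.
  by rewrite -ltnS => kn; apply/imsetP; exists (Ordinal kn).
have vP (x : induced A) : exists2 k, k <= n & val x = v k.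
  by have /imsetP[k _ xk] := valP x; exists k => //; rewrite -ltnS.
have PX (x : induced A) k : val x = v k -> P k -> x \in X.
  by move=> xk /existsP[y /andP[yX /eqP]]; rewrite -xk => /val_inj <-.
have unif p q k : p <= n -> q <= n -> k <= n -> P p -> P q -> ~~ P k ->
     adj (v k) (v p) = adj (v k) (v q).
  move=> pn qn kn /existsP[x /andP[xX /eqP Ex]] /existsP[y /andP[yX /eqP Ey]] nP.
  pose w : induced A := exist _ (v k) (memv k kn).
  have wX : w \notin X.
    by apply/negP => wX; case/negP: nP; apply/existsP; exists w; rewrite wX /=.
  have := hom w wX; rewrite -Ex -Ey -[v k]/(val w) -!inducedE.
  case=> h; first by rewrite !h.
  by rewrite (negbTE (h _ xX)) (negbTE (h _ yX)).
have /card_gt1P[x [y [xX yX xy]]] := X2.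
have [p pn Ex] := vP x; have [q qn Ey] := vP y.
have Pp : P p by apply/existsP; exists x; rewrite xX Ex /=.
have Pq : P q by apply/existsP; exists y; rewrite yX Ey /=.
have pq : p != q by apply: contraNneq xy => pq; apply/eqP/val_inj; rewrite Ex Ey pq.
have all : forall k, k <= n -> P k.
  have := chain_closed n2 ch v10 unif.
  move=> cl; case: (ltngtP p q) pq => // pq _.
    by apply: cl Pp Pq; rewrite pq qn.
  by apply: cl Pq Pp; rewrite pq pn.
suff XT : X = setT by move: XG; rewrite XT cardsT ltnn.
apply/setP => z; rewrite inE; have [k kn Ez] := vP z.
exact: PX Ez (all k kn).
Qed.

(** Dropping [v 0] or [v 1] leaves a chain with one vertex fewer. Since [v 2] separates these two
    and [v n.+1] does not, the one to keep can be chosen to meet the condition of [prime_chain]. *)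
Lemma long_chain (G : sgraph) (n : nat) (v : nat -> G) :
  2 < n -> is_chain n.+2 v -> unavoidable n G.
Proof.
move=> n2 [vinj ch].
have [i0 i01 Ei0] : exists2 i0, i0 < 2 & adj (v 2) (v i0) != adj (v n.+1) (v 0).
  have /= e := ch 2 0 isT ltac:(lia).
  case: (eqVneq (adj (v 2) (v 0)) (adj (v n.+1) (v 0))) => [h|h]; last by exists 0.
  by exists 1 => //; rewrite -h e; case: adj.
pose w k := v (if k == 0 then i0 else k.+1).
apply: (@prime_chain _ _ w) => //.
  split.
    move=> i j; rewrite !inE => in1 jn1 /vinj; rewrite !inE.
    by case: eqP => ?; case: eqP => ?; lia.
  move=> i j ji im; rewrite /w.
  have -> : (i == 0) = false by lia.
  rewrite (ch i.+1); [|by case: eqP; lia|lia].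
  have -> : (i.-1 == 0) = false by lia.
  rewrite /= prednK; last lia.
  by [].

rewrite /w /=; have -> : (n == 0) = false by lia.
by rewrite (ch n.+1 i0) -?(ch n.+1 0) //; lia.
Qed.

(** * Ramsey's theorem *)

Lemma pigeonhole (C : finType) (T : Type) (f : T -> C) (l : seq T) k :
  #|C| * k < size l -> exists c, k < count (fun x => f x == c) l.
Proof.
move=> kl; apply/existsP; apply: contraLR kl; rewrite negb_exists => /forallP h.
rewrite -leqNgt.
have -> : size l = \sum_(c : C) count (fun x => f x == c) l.
  elim: l {h} => [|x l IH] /=; first by rewrite big1.
  by rewrite big_split /= -IH (bigD1 (f x)) //= eqxx big1 // => c /negbTE; rewrite eq_sym => ->.
rewrite -sum_nat_const; apply: leq_sum => c _.
by rewrite leqNgt; apply: h.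
Qed.

(** Greedy selection from the left: the head is kept together with its most frequent colour, and
    only the elements seen in that colour survive. The colour of a pair thus depends on its first
    element, with which it is stored. *)
Lemma end_homogeneous (C : finType) m : exists N, forall (col : nat -> nat -> C) (l : seq nat),
  N <= size l -> exists t : seq (nat * C),
  [/\ subseq (map fst t) l, size t = m & pairwise (fun x y => col x.1 y.1 == x.2) t].
Proof.
elim: m => [|m [N IH]].
  by exists 0 => col l _; exists [::]; rewrite sub0seq.
exists (#|C| * N).+2 => col [|x l] //= Nl.
have [c] := @pigeonhole C _ (col x) l N Nl.
rewrite -size_filter => /ltnW/(IH col) [t [tl tm tp]].
exists ((x, c) :: t); rewrite /= eqxx tm tp; split=> //.
  by apply: subseq_trans tl _; exact: filter_subseq.
rewrite andbT; apply/allP => y yt /=.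
have /(mem_subseq tl) : y.1 \in map fst t by apply: map_f.
by rewrite mem_filter => /andP[].
Qed.

Lemma ramsey (C : finType) m : exists N, forall col : nat -> nat -> C,
  exists (s : nat -> nat) (c : C),
  [/\ forall i j, i < j < m -> s i < s j, forall i, i < m -> s i < N
    & forall i j, i < j < m -> col (s i) (s j) = c].
Proof.
(* More than [#|C| * m] entries force over [m] of them to store the same colour. *)
have [N HN] := end_homogeneous C (#|C| * m).+1; exists N => col.
have [t [tl tm tp]] := HN col (iota 0 N) ltac:(by rewrite size_iota).
have [c] := @pigeonhole C _ snd t m ltac:(by rewrite tm).
rewrite -size_filter; set u := filter _ _ => mu.
have ut : subseq u t by exact: filter_subseq.
have u_srt : pairwise ltn (map fst u).
  apply: subseq_pairwise (map_subseq _ ut) _; apply: subseq_pairwise tl _.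
  by rewrite -(sorted_pairwise ltn_trans) iota_ltn_sorted.
have u_col := subseq_pairwise ut tp.
pose s i := (nth (0, c) u i).1; exists s, c.
have sE i : i < m -> s i = nth 0 (map fst u) i.
  by move=> im; rewrite (nth_map (0, c)) //; apply: ltn_trans mu.
have lt i : i < m -> i < size u by move/ltn_trans; apply.
split.
- move=> i j /andP[ij jm]; rewrite !sE //; last exact: ltn_trans jm.
  move/pairwiseP: u_srt => /(_ 0 i j); rewrite !inE size_map; apply=> //; apply: lt => //.
  exact: ltn_trans jm.
- move=> i im; rewrite sE //.
  have : nth 0 (map fst u) i \in iota 0 N.
    apply: (mem_subseq tl); apply: (mem_subseq (map_subseq _ ut)).
    by rewrite mem_nth // size_map lt.
  by rewrite mem_iota.
- move=> i j /andP[ij jm]; have im := ltn_trans ij jm.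
  have /pairwiseP := u_col => /(_ (0, c) i j); rewrite !inE => /(_ (lt _ im) (lt _ jm) ij) /eqP.
  rewrite /s => ->; have := mem_nth (0, c) (lt _ im).
  by rewrite mem_filter => /andP[/eqP].
Qed.

(** * Induced embeddings *)

Definition separated (G : sgraph) (x y : G) : Prop :=
  exists z, [/\ z != x, z != y & adj x z != adj y z].

Lemma separated_sym (G : sgraph) (x y : G) : separated x y -> separated y x.
Proof. by case=> z [zx zy xyz]; exists z; split; rewrite // eq_sym. Qed.

Definition twinfree (G : sgraph) : Prop :=
  forall x y : G, x != y -> separated x y.

Lemma ord_other n (i : 'I_n) : 1 < n -> exists j, j != i.
Proof.
move=> n1; have /card_gt1P[x [y [_ _ xy]]] : 1 < #|'I_n| by rewrite card_ord.
by case: (eqVneq x i) => [<-|xi]; [exists y; rewrite eq_sym|exists x].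
Qed.

Lemma complE (G : sgraph) (x y : G) : x != y -> @adj (compl G) x y = ~~ adj x y.
Proof. by move=> xy; rewrite /= /sym_adj xy (adj_sym y) orbb. Qed.

(* Twins are the only obstruction to injectivity, so distinctness of the images need not
   be checked. *)
Lemma embed (G H : sgraph) (eps : bool) (f : H -> G) : twinfree H ->
  (forall x y, x != y -> adj (f x) (f y) = eps (+) adj x y) -> contains_or_compl G H.
Proof.
move=> tw fE; have finj : injective f.
  move=> x y fxy; apply/eqP; apply: contraT => /[dup] xy /tw[z [zx zy]].
  have := fE x z; have := fE y z; rewrite fxy eq_sym zy eq_sym zx => -> // /(_ isT).
  by move/addbI => ->; rewrite eqxx.
case: eps fE => fE; [right|left]; exists f => // x y.
  case: (eqVneq x y) => [->|xy]; first by rewrite !adj_irr.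
  by rewrite fE // complE //= addTb.
by case: (eqVneq x y) => [->|xy]; rewrite ?adj_irr // fE.
Qed.

Lemma contains_or_compl_trans (G H K : sgraph) :
  contains_induced H K -> contains_or_compl G H -> contains_or_compl G K.
Proof.
case=> g ginj gE [] [f finj fE]; [left|right]; exists (f \o g); do ?exact: inj_comp.
  by move=> x y; rewrite /= fE gE.
by move=> x y; rewrite /= fE /= /sym_adj !gE (inj_eq ginj).
Qed.

(* The line graph of [K_{2,n}] without the encoding of its vertices as edges. *)
Definition rook_graph (n : nat) : sgraph :=
  graph_of (fun u v : 'I_n + 'I_n =>
    match u, v with inl i, inr j => i == j | inr _, inl _ => false | _, _ => true end).

(* The 1-subdivision of [K_{1,n}]: centre [None], subdivision vertices [Some (inl i)]. *)
Definition subdivided_star (n : nat) : sgraph :=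
  graph_of (fun u v : option ('I_n + 'I_n) =>
    match u, v with
    | None, Some (inl _) => true
    | Some (inl i), Some (inr j) => i == j
    | _, _ => false end).

Lemma sum_ord_eqE n :
  (forall i j : 'I_n, (inl i == inl j :> 'I_n + 'I_n) = (i == j :> nat)) *
  (forall i j : 'I_n, (inr i == inr j :> 'I_n + 'I_n) = (i == j :> nat)) *
  (forall i j : 'I_n, (inl i == inr j :> 'I_n + 'I_n) = false) *
  (forall i j : 'I_n, (inr i == inl j :> 'I_n + 'I_n) = false).
Proof. by []. Qed.

Lemma option_eqE (T : eqType) :
  (forall x y : T, (Some x == Some y) = (x == y)) *
  (forall x : T, (Some x == None) = false) * (forall x : T, (None == Some x) = false).
Proof. by []. Qed.

Lemma thin_spiderE n :
  (forall i j : 'I_n, @adj (thin_spider n) (inl i) (inl j) = false) *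
  (forall i j : 'I_n, @adj (thin_spider n) (inr i) (inr j) = (i != j :> nat)) *
  (forall i j : 'I_n, @adj (thin_spider n) (inl i) (inr j) = (i == j :> nat)) *
  (forall i j : 'I_n, @adj (thin_spider n) (inr i) (inl j) = (i == j :> nat)).
Proof. by do !split=> *; rewrite /= /sym_adj /= ?andbF ?andbT ?orbF ?orbb -?val_eqE. Qed.

Lemma rook_graphE n :
  (forall i j : 'I_n, @adj (rook_graph n) (inl i) (inl j) = (i != j :> nat)) *
  (forall i j : 'I_n, @adj (rook_graph n) (inr i) (inr j) = (i != j :> nat)) *
  (forall i j : 'I_n, @adj (rook_graph n) (inl i) (inr j) = (i == j :> nat)) *
  (forall i j : 'I_n, @adj (rook_graph n) (inr i) (inl j) = (i == j :> nat)).
Proof. by do !split=> *; rewrite /= /sym_adj /= ?andbF ?andbT ?orbF ?orbb -?val_eqE. Qed.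

Lemma half_graphE n :
  (forall i j : 'I_n, @adj (half_graph n) (inl i) (inl j) = false) *
  (forall i j : 'I_n, @adj (half_graph n) (inr i) (inr j) = false) *
  (forall i j : 'I_n, @adj (half_graph n) (inl i) (inr j) = (j <= i)) *
  (forall i j : 'I_n, @adj (half_graph n) (inr i) (inl j) = (i <= j)).
Proof. by do !split=> *; rewrite /= /sym_adj /= ?andbF ?andbT ?orbF. Qed.

Lemma subdivided_starE n :
  (forall i : 'I_n, @adj (subdivided_star n) None (Some (inl i)) = true) *
  (forall i : 'I_n, @adj (subdivided_star n) None (Some (inr i)) = false) *
  (forall i j : 'I_n, @adj (subdivided_star n) (Some (inl i)) (Some (inl j)) = false) *
  (forall i j : 'I_n, @adj (subdivided_star n) (Some (inr i)) (Some (inr j)) = false) *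
  (forall i j : 'I_n, @adj (subdivided_star n) (Some (inl i)) (Some (inr j)) = (i == j :> nat)) *
  (forall i j : 'I_n, @adj (subdivided_star n) (Some (inr i)) (Some (inl j)) = (i == j :> nat)) *
  (forall i : 'I_n, @adj (subdivided_star n) (Some (inl i)) None = true) *
  (forall i : 'I_n, @adj (subdivided_star n) (Some (inr i)) None = false).
Proof. by do !split=> *; rewrite /= /sym_adj /= ?andbF ?andbT ?orbF ?orbb -?val_eqE. Qed.

Lemma half_split_graphE n :
  (forall i j : 'I_n, @adj (half_split_graph n) (inl i) (inl j) = false) *
  (forall i j : 'I_n, @adj (half_split_graph n) (inr i) (inr j) = (i != j :> nat)) *
  (forall i j : 'I_n, @adj (half_split_graph n) (inl i) (inr j) = (j <= i)) *
  (forall i j : 'I_n, @adj (half_split_graph n) (inr i) (inl j) = (i <= j)).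
Proof.
have L (k : 'I_n) : (inl k \in [set inr j | j : 'I_n]) = false.
  by apply/imsetP => -[].
have R (k : 'I_n) : (inr k \in [set inr j | j : 'I_n]) by apply: imset_f.
by do !split=> *;
  rewrite /= /sym_adj /= ?half_graphE /= /sym_adj /= ?L ?R ?andbF ?andbT ?orbF ?orbb ?andbb
  -?val_eqE.
Qed.

(** * Twin-freeness of the target graphs *)

Ltac separate z E := exists z; rewrite ?E ?option_eqE ?sum_ord_eqE; split=> //; lia.

Lemma thin_spider_twinfree n : 1 < n -> twinfree (thin_spider n).
Proof.
move=> n1.
have ab (i j : 'I_n) : @separated (thin_spider n) (inl i) (inr j).
  case: (eqVneq i j) => [->|]; last by rewrite -val_eqE /= => ij;
    separate (@inl 'I_n 'I_n j) thin_spiderE.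
  by have [k kj] := ord_other j n1; rewrite -val_eqE /= in kj;
    separate (@inr 'I_n 'I_n k) thin_spiderE.
move=> [i|i] [j|j]; rewrite ?sum_ord_eqE // => ij.
- separate (@inr 'I_n 'I_n i) thin_spiderE.
- exact/separated_sym.
- separate (@inl 'I_n 'I_n i) thin_spiderE.
Qed.

Lemma rook_graph_twinfree n : 2 < n -> twinfree (rook_graph n).
Proof.
move=> n2.
have ab (i j : 'I_n) : @separated (rook_graph n) (inl i) (inr j).
  (* The witness [inl k] must be adjacent to [inl i] and miss [inr j], hence a third index. For
     [n = 2] the graph is a 4-cycle, which has twins. *)
  have [k /andP[ki kj]] : exists k : 'I_n, (k != i) && (k != j).
    apply/existsP; apply: contraLR n2 => /existsPn h.
    rewrite -leqNgt -[n]card_ord; apply: leq_trans (_ : #|[set i; j]| <= 2);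
      last by rewrite cards2; case: eqP.
    rewrite -cardsT; apply/subset_leq_card/subsetP => k _; rewrite !inE.
    by have := h k; rewrite negb_and !negbK.
  rewrite -!val_eqE /= in ki kj; separate (@inl 'I_n 'I_n k) rook_graphE.
move=> [i|i] [j|j]; rewrite ?sum_ord_eqE // => ij.
- separate (@inr 'I_n 'I_n i) rook_graphE.
- exact/separated_sym.
- separate (@inl 'I_n 'I_n i) rook_graphE.
Qed.

Lemma half_graph_twinfree n : 1 < n -> twinfree (half_graph n).
Proof.
move=> n1.
have [z0 z0E] : exists k : 'I_n, k = 0 :> nat by exists (Ordinal (ltnW n1)).
have [z1 z1E] : exists k : 'I_n, k = n.-1 :> nat.
  by have n1n : n.-1 < n; [lia|exists (Ordinal n1n)].
have ab (i j : 'I_n) : @separated (half_graph n) (inl i) (inr j).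
  (* [inr 0] is complete to the other side and separates unless [j = 0]. Symmetrically [inl n.-1]
     separates unless [i = n.-1]. In the remaining case [inl 0] does. *)
  have [j0|j0] := eqVneq (j : nat) 0; last by separate (@inr 'I_n 'I_n z0) half_graphE.
  have [i1|i1] := eqVneq (i : nat) n.-1; last by have := ltn_ord i;
    separate (@inl 'I_n 'I_n z1) half_graphE.
  separate (@inl 'I_n 'I_n z0) half_graphE.
move=> [i|i] [j|j]; rewrite ?sum_ord_eqE // => ij.
- by case: (ltngtP i j) ij => // lt _; [|apply: separated_sym];
    [separate (@inr 'I_n 'I_n j) half_graphE|separate (@inr 'I_n 'I_n i) half_graphE].
- exact/separated_sym.
- by case: (ltngtP i j) ij => // lt _; [|apply: separated_sym];
    [separate (@inl 'I_n 'I_n i) half_graphE|separate (@inl 'I_n 'I_n j) half_graphE].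
Qed.

Lemma subdivided_star_twinfree n : 1 < n -> twinfree (subdivided_star n).
Proof.
move=> n1.
have ab (i j : 'I_n) : @separated (subdivided_star n) (Some (inl i)) (Some (inr j)).
  case: (eqVneq i j) => [->|]; first by separate (@None ('I_n + 'I_n)) subdivided_starE.
  by rewrite -val_eqE /= => ij; separate (Some (@inr 'I_n 'I_n i)) subdivided_starE.
have cx (i : 'I_n) : @separated (subdivided_star n) None (Some (inl i)).
  separate (Some (@inr 'I_n 'I_n i)) subdivided_starE.
have cy (i : 'I_n) : @separated (subdivided_star n) None (Some (inr i)).
  by have [k kj] := ord_other i n1; rewrite -val_eqE /= in kj;
    separate (Some (@inl 'I_n 'I_n k)) subdivided_starE.
move=> [[i|i]|] [[j|j]|]; rewrite ?option_eqE ?sum_ord_eqE // => ij; try exact/separated_sym.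
- separate (Some (@inr 'I_n 'I_n i)) subdivided_starE.
- separate (Some (@inl 'I_n 'I_n i)) subdivided_starE.
Qed.

Lemma add_vertexE (G : sgraph) (A : {set G}) (x y : G) :
  @adj (add_vertex A) (Some x) (Some y) = adj x y.
Proof.
rewrite [LHS]/= /sym_adj option_eqE (adj_sym y) orbb.
by case: eqVneq => // ->; rewrite adj_irr.
Qed.

Lemma half_split_IE n :
  (forall i : 'I_n, @adj (half_split_I n) None (Some (inl i)) = true) *
  (forall i : 'I_n, @adj (half_split_I n) None (Some (inr i)) = false) *
  (forall i : 'I_n, @adj (half_split_I n) (Some (inl i)) None = true) *
  (forall i : 'I_n, @adj (half_split_I n) (Some (inr i)) None = false) *
  (forall i j : 'I_n, @adj (half_split_I n) (Some (inl i)) (Some (inl j)) = false) *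
  (forall i j : 'I_n, @adj (half_split_I n) (Some (inr i)) (Some (inr j)) = (i != j :> nat)) *
  (forall i j : 'I_n, @adj (half_split_I n) (Some (inl i)) (Some (inr j)) = (j <= i)) *
  (forall i j : 'I_n, @adj (half_split_I n) (Some (inr i)) (Some (inl j)) = (i <= j)).
Proof.
have L (k : 'I_n) : inl k \in [set inl j | j : 'I_n] by apply: imset_f.
have R (k : 'I_n) : (inr k \in [set inl j | j : 'I_n]) = false.
  by apply/imsetP => -[].
by do !split=> *; rewrite ?add_vertexE ?half_split_graphE //= /sym_adj /= ?L ?R.
Qed.

Lemma half_split_starE n :
  (forall i : 'I_n, @adj (half_split_star n) None (Some (inl i)) = (i.+1 == n)) *
  (forall i : 'I_n, @adj (half_split_star n) None (Some (inr i)) = false) *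
  (forall i : 'I_n, @adj (half_split_star n) (Some (inl i)) None = (i.+1 == n)) *
  (forall i : 'I_n, @adj (half_split_star n) (Some (inr i)) None = false) *
  (forall i j : 'I_n, @adj (half_split_star n) (Some (inl i)) (Some (inl j)) = false) *
  (forall i j : 'I_n, @adj (half_split_star n) (Some (inr i)) (Some (inr j)) = (i != j :> nat)) *
  (forall i j : 'I_n, @adj (half_split_star n) (Some (inl i)) (Some (inr j)) = (j <= i)) *
  (forall i j : 'I_n, @adj (half_split_star n) (Some (inr i)) (Some (inl j)) = (i <= j)).
Proof.
have L (k : 'I_n) : (inl k \in [set inl j | j : 'I_n & j.+1 == n]) = (k.+1 == n).
  apply/imsetP/eqP => [[l]|kn]; first by rewrite inE => /eqP ln [->].
  by exists k => //; rewrite inE kn.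
have R (k : 'I_n) : (inr k \in [set inl j | j : 'I_n & j.+1 == n]) = false.
  by apply/imsetP => -[].
by do !split=> *; rewrite ?add_vertexE ?half_split_graphE //= /sym_adj /= ?L ?R ?orbF.
Qed.

Lemma half_split_I_twinfree n : 1 < n -> twinfree (half_split_I n).
Proof.
move=> n1.
have ab (i j : 'I_n) : @separated (half_split_I n) (Some (inl i)) (Some (inr j)).
  separate (@None ('I_n + 'I_n)) half_split_IE.
have ca (i : 'I_n) : @separated (half_split_I n) None (Some (inl i)).
  by have [k kj] := ord_other i n1; rewrite -val_eqE /= in kj;
    separate (Some (@inl 'I_n 'I_n k)) half_split_IE.
have cb (i : 'I_n) : @separated (half_split_I n) None (Some (inr i)).
  by have [k kj] := ord_other i n1; rewrite -val_eqE /= in kj;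
    separate (Some (@inr 'I_n 'I_n k)) half_split_IE.
move=> [[i|i]|] [[j|j]|]; rewrite ?option_eqE ?sum_ord_eqE // => ij; try exact/separated_sym.
- by case: (ltngtP i j) ij => // lt _; [|apply: separated_sym];
    [separate (Some (@inr 'I_n 'I_n j)) half_split_IE|separate (Some (@inr 'I_n 'I_n i))
      half_split_IE].
- by case: (ltngtP i j) ij => // lt _; [|apply: separated_sym];
    [separate (Some (@inl 'I_n 'I_n i)) half_split_IE|separate (Some (@inl 'I_n 'I_n j))
      half_split_IE].
Qed.

Lemma half_split_star_twinfree n : 1 < n -> twinfree (half_split_star n).
Proof.
move=> n1.
have [z0 z0E] : exists k : 'I_n, k = 0 :> nat by exists (Ordinal (ltnW n1)).
have [z1 z1E] : exists k : 'I_n, k = n.-1 :> nat.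
  by have n1n : n.-1 < n; [lia|exists (Ordinal n1n)].
have ab (i j : 'I_n) : @separated (half_split_star n) (Some (inl i)) (Some (inr j)).
  have [i1|i1] := eqVneq (i : nat) n.-1; first by separate (@None ('I_n + 'I_n)) half_split_starE.
  have := ltn_ord j; separate (Some (@inl 'I_n 'I_n z1)) half_split_starE.
have ca (i : 'I_n) : @separated (half_split_star n) None (Some (inl i)).
  separate (Some (@inr 'I_n 'I_n z0)) half_split_starE.
have cb (i : 'I_n) : @separated (half_split_star n) None (Some (inr i)).
  by have [k kj] := ord_other i n1; rewrite -val_eqE /= in kj;
    separate (Some (@inr 'I_n 'I_n k)) half_split_starE.
move=> [[i|i]|] [[j|j]|]; rewrite ?option_eqE ?sum_ord_eqE // => ij; try exact/separated_sym.
- by case: (ltngtP i j) ij => // lt _; [|apply: separated_sym];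
    [separate (Some (@inr 'I_n 'I_n j)) half_split_starE|separate (Some (@inr 'I_n 'I_n i))
      half_split_starE].
- by case: (ltngtP i j) ij => // lt _; [|apply: separated_sym];
    [separate (Some (@inl 'I_n 'I_n i)) half_split_starE|separate (Some (@inl 'I_n 'I_n j))
      half_split_starE].
Qed.

(** * Line graphs and subdivisions of complete bipartite graphs *)

Lemma bipartite_edge m n : exists g : edge (complete_bipartite m n) -> 'I_m * 'I_n,
  forall e, val e = [set inl (g e).1; inr (g e).2].
Proof.
apply: (@fin_all_exists _ (fun=> ('I_m * 'I_n)%type)
  (fun e p => val e = [set inl p.1; inr p.2])) => e.
have := valP e; rewrite inE => /existsP[x /existsP[y /andP[]]].
case: x y => [i|j] [i'|j'] //=; rewrite /sym_adj ?andbF // => _ /eqP ->.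
  by exists (i, j').
by exists (i', j); rewrite setUC.
Qed.

(** Two edges meet iff they share an end on one of the two sides. The end on the two-element side
    becomes the tag [inl] or [inr]. *)
Lemma rook_graph_line n :
  contains_induced (rook_graph n) (line_graph (complete_bipartite 2 n)).
Proof.
have [g gE] := bipartite_edge 2 n.
have ginj : injective g by move=> e e' h; apply: val_inj; rewrite !gE h.
pose f e : rook_graph n := if (g e).1 == ord0 then inl (g e).2 else inr (g e).2.
have row_eq (i j : 'I_2) : (i == j) = ((i == ord0) == (j == ord0)).
  by rewrite -!val_eqE /=; have := ltn_ord i; have := ltn_ord j; lia.
have finj : injective f.
  move=> e e' fe; apply: ginj; move: fe; rewrite /f.
  have := row_eq (g e).1 (g e').1.
  case: (g e) (g e') => [i j] [i' j'] /=.
  by case: (i == ord0) (i' == ord0) => -[] //= /eqP -> [->].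
exists f => // e e'.
have meet (d d' : edge (complete_bipartite 2 n)) : (val d :&: val d' != set0) =
    ((g d).1 == (g d').1) || ((g d).2 == (g d').2).
  rewrite !gE; apply/set0Pn/orP => [[z]|[/eqP h|/eqP h]].
  - by rewrite !inE => /andP[/orP[]/eqP-> /orP[]// h]; [left|right].
  - by exists (inl (g d).1); rewrite !inE h eqxx.
  - by exists (inr (g d).2); rewrite !inE h eqxx orbT.
rewrite [RHS]/= /sym_adj !meet (eq_sym (g e').1) (eq_sym (g e').2) orbb -(inj_eq finj).
rewrite /f (row_eq (g e).1 (g e').1).
by case: ((g e).1 == ord0); case: ((g e').1 == ord0);
  rewrite ?rook_graphE ?sum_ord_eqE /= ?andbT -?val_eqE.
Qed.

Lemma subdivided_star_subdivision n :
  contains_induced (subdivided_star n) (subdivision (complete_bipartite 1 n)).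
Proof.
have [g gE] := bipartite_edge 1 n.
have ginj : injective g by move=> e e' h; apply: val_inj; rewrite !gE h.
pose f (u : subdivision (complete_bipartite 1 n)) : subdivided_star n :=
  match u with
  | inl (inl _) => None
  | inl (inr j) => Some (inr j)
  | inr e => Some (inl (g e).2)
  end.
exists f.
  move=> [[i|i]|e] [[j|j]|e'] //=; first by rewrite (ord1 i) (ord1 j).
    by move=> [->].
  move=> [h]; congr inr; apply: ginj; case: (g e) (g e') h => [i j] [i' j'] /= ->.
  by rewrite (ord1 i) (ord1 i').
move=> [[i|i]|e] [[j|j]|e'] //=;
  rewrite /sym_adj /= ?andbF ?orbF ?gE //= ?inE ?(ord1 (g _).1) ?(ord1 i) ?(ord1 j) /= ?eqxx ?orbF
  //.
all: by rewrite 1?eq_sym.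
Qed.

(** * Recognising the target graphs from sequences of vertices *)

Section Builders.
Variables (G : sgraph) (n : nat) (eps : bool) (x y : nat -> G).
Hypothesis n2 : 2 < n.

(** In this section [eps = true] yields the complement of the named graph. Distinctness of the
    vertices is never assumed, since [embed] derives it from twin-freeness. *)
Lemma thin_spider_of :
  (forall i j, i < n -> j < n -> i != j -> adj (x i) (x j) = eps) ->
  (forall i j, i < n -> j < n -> i != j -> adj (y i) (y j) = ~~ eps) ->
  (forall i j, i < n -> j < n -> adj (x i) (y j) = eps (+) (i == j)) ->
  unavoidable n G.
Proof.
move=> xx yy xy; do 2 right; left.
apply: (@embed _ _ eps (fun u : thin_spider n => match u with inl i => x i | inr i => y i end)).
  exact: thin_spider_twinfree (ltnW n2).
move=> [i|i] [j|j]; rewrite ?thin_spiderE ?sum_ord_eqE => ij.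
- by rewrite xx // addbF.
- by rewrite xy.
- by rewrite adj_sym xy // eq_sym.
- by rewrite yy // ij addbT.
Qed.

Lemma line_graph_of :
  (forall i j, i < n -> j < n -> i != j -> adj (x i) (x j) = ~~ eps) ->
  (forall i j, i < n -> j < n -> i != j -> adj (y i) (y j) = ~~ eps) ->
  (forall i j, i < n -> j < n -> adj (x i) (y j) = eps (+) (i == j)) ->
  unavoidable n G.
Proof.
move=> xx yy xy; right; left; apply: contains_or_compl_trans (rook_graph_line n) _.
apply: (@embed _ _ eps (fun u : rook_graph n => match u with inl i => x i | inr i => y i end)).
  exact: rook_graph_twinfree n2.
move=> [i|i] [j|j]; rewrite ?rook_graphE ?sum_ord_eqE => ij.
- by rewrite xx // ij addbT.
- by rewrite xy.
- by rewrite adj_sym xy // eq_sym.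
- by rewrite yy // ij addbT.
Qed.

Lemma half_graph_of :
  (forall i j, i < n -> j < n -> i != j -> adj (x i) (x j) = eps) ->
  (forall i j, i < n -> j < n -> i != j -> adj (y i) (y j) = eps) ->
  (forall i j, i < n -> j < n -> adj (x i) (y j) = eps (+) (j <= i)) ->
  unavoidable n G.
Proof.
move=> xx yy xy; do 3 right; left.
apply: (@embed _ _ eps (fun u : half_graph n => match u with inl i => x i | inr i => y i end)).
  exact: half_graph_twinfree (ltnW n2).
move=> [i|i] [j|j]; rewrite ?half_graphE ?sum_ord_eqE => ij.
- by rewrite xx // addbF.
- by rewrite xy.
- by rewrite adj_sym xy.
- by rewrite yy // addbF.
Qed.

Lemma subdivision_of (c : G) :
  (forall i j, i < n -> j < n -> i != j -> adj (x i) (x j) = eps) ->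
  (forall i j, i < n -> j < n -> i != j -> adj (y i) (y j) = eps) ->
  (forall i j, i < n -> j < n -> adj (x i) (y j) = eps (+) (i == j)) ->
  (forall i, i < n -> adj c (x i) = ~~ eps) ->
  (forall i, i < n -> adj c (y i) = eps) ->
  unavoidable n G.
Proof.
move=> xx yy xy cx cy; left; apply: contains_or_compl_trans (subdivided_star_subdivision n) _.
apply: (@embed _ _ eps (fun u : subdivided_star n => match u with
  Some (inl i) => x i | Some (inr i) => y i | None => c end)).
  exact: subdivided_star_twinfree (ltnW n2).
move=> [[i|i]|] [[j|j]|]; rewrite ?subdivided_starE ?option_eqE ?sum_ord_eqE => ij //.
- by rewrite xx // addbF.
- by rewrite xy.
- by rewrite adj_sym cx // addbT.
- by rewrite adj_sym xy // eq_sym.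
- by rewrite yy // addbF.
- by rewrite adj_sym cy // addbF.
- by rewrite cx // addbT.
- by rewrite cy // addbF.
Qed.

Lemma half_split_I_of (c : G) :
  (forall i j, i < n -> j < n -> i != j -> adj (x i) (x j) = eps) ->
  (forall i j, i < n -> j < n -> i != j -> adj (y i) (y j) = ~~ eps) ->
  (forall i j, i < n -> j < n -> adj (x i) (y j) = eps (+) (j <= i)) ->
  (forall i, i < n -> adj c (x i) = ~~ eps) ->
  (forall i, i < n -> adj c (y i) = eps) ->
  unavoidable n G.
Proof.
move=> xx yy xy cx cy; do 4 right; left.
apply: (@embed _ _ eps (fun u : half_split_I n => match u with
  Some (inl i) => x i | Some (inr i) => y i | None => c end)).
  exact: half_split_I_twinfree (ltnW n2).
move=> [[i|i]|] [[j|j]|]; rewrite ?half_split_IE ?option_eqE ?sum_ord_eqE => ij //.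
- by rewrite xx // addbF.
- by rewrite xy.
- by rewrite adj_sym cx // addbT.
- by rewrite adj_sym xy.
- by rewrite yy // ij addbT.
- by rewrite adj_sym cy // addbF.
- by rewrite cx // addbT.
- by rewrite cy // addbF.
Qed.

Lemma half_split_star_of (c : G) :
  (forall i j, i < n -> j < n -> i != j -> adj (x i) (x j) = eps) ->
  (forall i j, i < n -> j < n -> i != j -> adj (y i) (y j) = ~~ eps) ->
  (forall i j, i < n -> j < n -> adj (x i) (y j) = eps (+) (j <= i)) ->
  (forall i, i < n -> adj c (x i) = eps (+) (i.+1 == n)) ->
  (forall i, i < n -> adj c (y i) = eps) ->
  unavoidable n G.
Proof.
move=> xx yy xy cx cy; do 5 right; left.
apply: (@embed _ _ eps (fun u : half_split_star n => match u with
  Some (inl i) => x i | Some (inr i) => y i | None => c end)).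
  exact: half_split_star_twinfree (ltnW n2).
move=> [[i|i]|] [[j|j]|]; rewrite ?half_split_starE ?option_eqE ?sum_ord_eqE => ij //.
- by rewrite xx // addbF.
- by rewrite xy.
- by rewrite adj_sym cx.
- by rewrite adj_sym xy.
- by rewrite yy // ij addbT.
- by rewrite adj_sym cy // addbF.
- by rewrite cx.
- by rewrite cy // addbF.
Qed.
End Builders.

(** * Chains in prime graphs *)

Lemma is_chain_rcons (G : sgraph) (x0 v w : G) (s : seq G) :
  is_chain (size s).+1 (nth x0 (rcons s w)) -> v \notin rcons s w ->
  {in s, forall u, adj v u = ~~ adj v w} ->
  is_chain (size s).+2 (nth x0 (rcons (rcons s w) v)).
Proof.
move=> [inj ch] vs vw; split.
  have : uniq (rcons (rcons s w) v).
    by rewrite rcons_uniq vs; apply/(uniqP x0); rewrite size_rcons.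
  by move/(uniqP x0); rewrite !size_rcons.
move=> i j ji im;
  rewrite (nth_rcons _ (rcons s w)) (nth_rcons _ (rcons s w)) (nth_rcons _ (rcons s w)) !size_rcons.
have -> : j < (size s).+1 by lia.
have -> : i.-1 < (size s).+1 by lia.
have [lt|lt] := ltnP i (size s).+1; first exact: ch.
have -> : i = (size s).+1 by lia.
rewrite eqxx /= nth_rcons; have js : j < size s by lia.
by rewrite js nth_rcons ltnn eqxx; apply: vw; rewrite mem_nth.
Qed.

(** Start with [x, y] and repeatedly add all vertices mixed on the current set. The process can only
    stop at a set containing [z], because otherwise that set would be homogeneous. A chain is then
    read off backwards through the levels. *)
Lemma chain_exists (G : sgraph) (x y z : G) :
  prime_graph G -> x != y -> z != x -> z != y ->
  exists s, is_chain (size s).+3 (nth x [:: x, y & rcons s z]).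
Proof.
move=> prG xy zx zy.
pose mixed (X : {set G}) v := [exists u in X, exists w in X, adj v u != adj v w].
pose F X := [set x; y] :|: [set v | mixed X v].
pose L k := iter k F set0.
have mixedS (X Y : {set G}) v : X \subset Y -> mixed X v -> mixed Y v.
  move=> XY /existsP[u /andP[uX /existsP[w /andP[wX h]]]].
  by apply/existsP; exists u; rewrite (subsetP XY) //; apply/existsP; exists w;
    rewrite (subsetP XY).
have Fmono : {homo F : X Y / X \subset Y}.
  move=> X Y XY; apply: setUS; apply/subsetP => v; rewrite !inE; exact: mixedS.
have LS k : L k \subset L k.+1.
  by elim: k => [|k IH]; [exact: sub0set|exact: Fmono].
have xL k : x \in L k.+1 by rewrite !inE eqxx.
have yL k : y \in L k.+1 by rewrite !inE eqxx orbT.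
have fixF := fixsetK Fmono.
have zfix : z \in fixset F.
  apply: contraT => zF; exfalso; apply: (prG (fixset F)).
  have xF : x \in fixset F by rewrite -fixF !inE eqxx.
  have yF : y \in fixset F by rewrite -fixF !inE eqxx orbT.
  split.
    apply/andP; split; first by apply/card_gt1P; exists x, y.
    rewrite -cardsT; apply: proper_card; rewrite properE subsetT /=.
    by apply: contra zF => /subsetP; apply.
  move=> v; rewrite -{1}fixF !inE negb_or => /andP[_ nv].
  have same u : u \in fixset F -> adj v u = adj v x.
    move=> uF; apply/eqP; apply: contraT => h; case/negP: nv.
    by apply/existsP; exists u; rewrite uF; apply/existsP; exists x; rewrite xF.
  by case E: (adj v x); [left|right] => u /same ->; rewrite E.
(* A vertex new at one level is uniform on the level two below and mixed on the one just below. It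
   therefore differs there on some vertex [w] that is itself new, and [w] is its predecessor in the
   chain. *)
suff main : forall k v, v \in L k.+2 -> v \notin L k.+1 -> exists2 s,
    is_chain (size s).+3 (nth x [:: x, y & rcons s v]) & {subset [:: x, y & s] <= L k.+1}.
  (* [fixset F] is by definition the iterate number [#|G|], that is [L #|G|]. *)
  have exk : exists k, z \in L k by exists #|G|.
  case: (ex_minnP exk) => -[|[|k]] zk mink.
  - by rewrite inE in zk.
  - case/negP: (negbTE zx); move: zk; rewrite !inE (negbTE zx) (negbTE zy) /=.
    by case/existsP=> u /andP[]; rewrite inE.
  - have [|s ch _] := main k z zk; last by exists s.
    by apply/negP => /mink; rewrite ltnn.
have LSE k v : (v \in L k.+1) = (v \in [set x; y]) || mixed (L k) v.
  by rewrite /L iterS /F in_setU [X in _ || X]inE.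
elim=> [|k IH] v vk nvk.
  have vx : v != x by apply: contraNneq nvk => ->.
  have vy : v != y by apply: contraNneq nvk => ->.
  have L1 u : u \in L 1 -> (u == x) || (u == y).
    by rewrite LSE !inE => /orP[//|/existsP[w /andP[]]]; rewrite inE.
  exists [::].
    2: by move=> u; rewrite in_cons mem_seq1 => /orP[]/eqP->; [exact: xL|exact: yL].
  apply: (@is_chain_rcons _ x v y [:: x]); rewrite ?inE ?negb_or ?vx //.
    split=> [|i j]; last by rewrite /=; lia.
    by apply: (elimT (uniqP x) (_ : uniq [:: x; y])); rewrite /= inE xy.
  move=> _ /[!inE] /eqP->; move: vk; rewrite LSE !inE (negbTE vx) (negbTE vy) /=.
  case/existsP=> u /andP[/L1 uL /existsP[w /andP[/L1 wL]]].
  by case/orP: uL => /eqP->; case/orP: wL => /eqP->; rewrite ?eqxx //; do 2 case: adj.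
have nm : ~~ mixed (L k.+1) v by move: nvk; rewrite LSE negb_or => /andP[].
have [w wL wx] : exists2 w, w \in L k.+2 & adj v w != adj v x.
  move: vk; rewrite LSE => /orP[vxy|].
    by case/negP: nvk; rewrite LSE vxy.
  case/existsP=> u /andP[uL /existsP[w /andP[wL]]].
  have [<-|h] := eqVneq (adj v u) (adj v x); last by exists u.
  by exists w; rewrite // eq_sym.
have same u : u \in L k.+1 -> adj v u = adj v x.
  move=> uL; apply/eqP; apply: contraT => h; case/negP: nm.
  by apply/existsP; exists u; rewrite uL; apply/existsP; exists x; rewrite xL.
have [|s ch sL] := IH w wL.
  by apply: contra wx => /same ->.
exists (rcons s w); last first.
  move=> u; rewrite -2!rcons_cons mem_rcons inE => /orP[/eqP->//|/sL].
  exact/subsetP/LS.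
rewrite size_rcons; apply: (@is_chain_rcons _ x v w [:: x, y & s]) => //.
  apply: contra nvk; rewrite mem_rcons inE => /orP[/eqP->//|/sL].
  exact/subsetP/LS.
by move=> u /sL/same ->; case: adj wx; case: adj.
Qed.

Lemma chain_or_unavoidable (G : sgraph) (n : nat) (x y z : G) :
  2 < n -> prime_graph G -> x != y -> z != x -> z != y ->
  unavoidable n G \/ exists (v : nat -> G) (l : nat),
    [/\ is_chain l.+1 v, v 0 = x, v 1 = y, v l = z & 1 < l <= n].
Proof.
move=> n2 prG xy zx zy; have [s ch] := chain_exists prG xy zx zy.
(* The list has [(size s).+3] vertices, so the chain has length [(size s).+2]. If this exceeds [n],
   an initial segment suits [long_chain]. *)
have [ln|nl] := leqP (size s).+2 n; last first.
  left; apply: (long_chain n2 (v := nth x [:: x, y & rcons s z])).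
  have [inj chP] := ch; split=> [i j|i j ji im]; last by apply: chP => //; lia.
  by rewrite !inE => im jm; apply: inj; rewrite inE; lia.
right; exists (nth x [:: x, y & rcons s z]), (size s).+2; split=> //.
by rewrite /= nth_rcons ltnn eqxx.
Qed.

(** * Homogeneous arrays *)

(** The colour of a pair of rows records the adjacencies between them, and also the value [kap] and
    the inner adjacencies of the first row. *)
Lemma array_ramsey (c K m : nat) : exists N, forall (G : sgraph) (v : nat -> nat -> G)
  (kap : nat -> 'I_K), exists (s : nat -> nat) (A D : nat -> nat -> bool) (k : 'I_K),
  [/\ forall i j, i < j < m -> s i < s j, forall i, i < m -> s i < N,
      forall i, i < m -> kap (s i) = k,
      forall i j p q, i < j < m -> p <= c -> q <= c -> adj (v (s i) p) (v (s j) q) = A p q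
    & forall i p q, i < m -> p <= c -> q <= c -> adj (v (s i) p) (v (s i) q) = D p q].
Proof.
pose M := {ffun 'I_c.+1 * 'I_c.+1 -> bool}.
(* One extra row: every [i < m] is the first element of the pair [(i, m)], whose colour fixes the
   data of row [i] alone. *)
have [N HN] := ramsey ('I_K * M * M)%type m.+1; exists N => G v kap.
pose mx i j : M := [ffun pq => adj (v i (val pq.1)) (v j (val pq.2))].
have [s [[[k fD] fA] [sinc sN col]]] := HN (fun i j => (kap i, mx i i, mx i j)).
have ap (f : M) i j p q : mx i j = f -> p <= c -> q <= c ->
    adj (v i p) (v j q) = f (inord p, inord q).
  by move=> <- pc qc; rewrite ffunE /= !inordK.
exists s, (fun p q => fA (inord p, inord q)), (fun p q => fD (inord p, inord q)), k.
split.
- by move=> i j ijm; apply: sinc; lia.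
- by move=> i im; apply: sN; lia.
- by move=> i im; have [] := col i m ltac:(lia).
- by move=> i j p q ijm; apply: ap; have [] := col i j ltac:(lia).
- by move=> i p q im; apply: ap; have [] := col i m ltac:(lia).
Qed.

(* A half split graph: in the order [d 0, a 0, d 1, a 1, ...] every [d i] is complete
   and every [a i] anticomplete to all later vertices. *)
Definition threshold (m : nat) (G : sgraph) : Prop :=
  exists d a : nat -> G,
  [/\ forall i j, i < m -> j < m -> adj (d i) (d j) = (i != j),
      forall i j, i < m -> j < m -> adj (a i) (a j) = false
    & forall i j, i < m -> j < m -> adj (d i) (a j) = (i <= j)].

(** If the diagonal is non-adjacent, shifting [x] by one moves it below the diagonal, at the cost of
    one index. *)
Lemma half_normal_aux (G : sgraph) (m : nat) (x y : nat -> G) (a b d : bool) :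
  (forall i j, i < m -> j < m -> i != j -> adj (x i) (x j) = a) ->
  (forall i j, i < m -> j < m -> i != j -> adj (y i) (y j) = b) ->
  (forall i j, i < j < m -> adj (x i) (y j) = false) ->
  (forall i j, i < j < m -> adj (x j) (y i) = true) ->
  (forall i, i < m -> adj (x i) (y i) = d) ->
  exists x' y' : nat -> G,
  [/\ forall i j, i < m.-1 -> j < m.-1 -> i != j -> adj (x' i) (x' j) = a,
      forall i j, i < m.-1 -> j < m.-1 -> i != j -> adj (y' i) (y' j) = b
    & forall i j, i < m.-1 -> j < m.-1 -> adj (x' i) (y' j) = (j <= i)].
Proof.
move=> xx yy lt gt eq; case: d eq => eq.
  exists x, y; split=> i j im jm; last 1 first.
  - case: (ltngtP i j) => [ij|ji|<-]; [apply: lt|apply: gt|apply: eq]; lia.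
  - by apply: xx; lia.
  - by apply: yy; lia.
exists (fun i => x i.+1), y; split=> i j im jm; last 1 first.
- case: (ltngtP i.+1 j) => [ij|ji|<-]; [rewrite lt|rewrite gt|rewrite eq]; lia.
- by move=> ij; apply: xx; lia.
- by apply: yy; lia.
Qed.

(** Reversing the order of the indices exchanges the two values of [c]. *)
Lemma half_normal (G : sgraph) (m : nat) (x y : nat -> G) (a b c d : bool) :
  (forall i j, i < m -> j < m -> i != j -> adj (x i) (x j) = a) ->
  (forall i j, i < m -> j < m -> i != j -> adj (y i) (y j) = b) ->
  (forall i j, i < j < m -> adj (x i) (y j) = c) ->
  (forall i j, i < j < m -> adj (x j) (y i) = ~~ c) ->
  (forall i, i < m -> adj (x i) (y i) = d) ->
  exists x' y' : nat -> G,
  [/\ forall i j, i < m.-1 -> j < m.-1 -> i != j -> adj (x' i) (x' j) = a,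
      forall i j, i < m.-1 -> j < m.-1 -> i != j -> adj (y' i) (y' j) = b
    & forall i j, i < m.-1 -> j < m.-1 -> adj (x' i) (y' j) = (j <= i)].
Proof.
case: c => xx yy lt gt eq; last exact: half_normal_aux xx yy lt gt eq.
apply: (@half_normal_aux _ _ (fun i => x (m.-1 - i)) (fun i => y (m.-1 - i)) a b d).
- by move=> i j im jm ij; apply: xx; lia.
- by move=> i j im jm ij; apply: yy; lia.
- by move=> i j ij; apply: gt; lia.
- by move=> i j ij; apply: lt; lia.
- by move=> i im; apply: eq; lia.
Qed.

(** If [e = c], the columns form a matching or co-matching, and [a], [b] decide between spider, line
    graph and the last outcome. Otherwise they form a half graph, which is a target or its
    complement if [a = b], and a half split graph if not. *)
Lemma classify (n m : nat) (G : sgraph) (x y : nat -> G) (a b c d e : bool) :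
  2 < n -> n.+1 < m ->
  (forall i j, i < m -> j < m -> i != j -> adj (x i) (x j) = a) ->
  (forall i j, i < m -> j < m -> i != j -> adj (y i) (y j) = b) ->
  (forall i j, i < j < m -> adj (x i) (y j) = c) ->
  (forall i j, i < j < m -> adj (x j) (y i) = e) ->
  (forall i, i < m -> adj (x i) (y i) = d) ->
  ~~ ((c == d) && (d == e)) ->
  unavoidable n G \/ threshold m.-1 G \/ [/\ a = c, b = c, e = c & d = ~~ c].
Proof.
move=> n2 nm xx yy lt gt eq nt.
have [ec|ec] := eqVneq e c.
  have dc : d = ~~ c by move: nt; rewrite ec (eq_sym d) andbb; case: (c) (d) => -[].
  have xy i j : i < n -> j < n -> adj (x i) (y j) = c (+) (i == j).
    move=> im jm; case: (ltngtP i j) => [ij|ij|<-].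
    - by rewrite addbF lt; lia.
    - by rewrite addbF gt ?ec; lia.
    - by rewrite addbT eq ?dc; lia.
  have yx i j : i < n -> j < n -> adj (y i) (x j) = c (+) (i == j).
    by move=> im jm; rewrite adj_sym xy // eq_sym.
  have xx' i j : i < n -> j < n -> i != j -> adj (x i) (x j) = a.
    by move=> im jm ij; apply: xx; lia.
  have yy' i j : i < n -> j < n -> i != j -> adj (y i) (y j) = b.
    by move=> im jm ij; apply: yy; lia.
  have [ac|ac] := eqVneq a c; have [bc|bc] := eqVneq b c; first by do 2 right.
  - left; apply: (thin_spider_of (eps := c) (x := x) (y := y) n2) => // i j im jm ij.
      by rewrite xx' // ac.
    by rewrite yy' //; case: (b) (c) bc => -[].
  - left; apply: (thin_spider_of (eps := c) (x := y) (y := x) n2) => // i j im jm ij.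
      by rewrite yy' // bc.
    by rewrite xx' //; case: (a) (c) ac => -[].
  - left; apply: (line_graph_of (eps := c) (x := x) (y := y) n2) => // i j im jm ij.
      by rewrite xx' //; case: (a) (c) ac => -[].
    by rewrite yy' //; case: (b) (c) bc => -[].
have {}gt : forall i j, i < j < m -> adj (x j) (y i) = ~~ c.
  by move=> i j /gt->; case: (e) (c) ec => -[].
have [x' [y' [xx' yy' xy']]] := half_normal xx yy lt gt eq.
case: a b xx' yy' {xx yy lt gt eq nt} => -[] xx' yy'.
(* Complementing turns [<=] into a strict inequality, so [y'] is shifted by one. This is what
   [n.+1 < m] pays for. *)
- left; apply: (half_graph_of (eps := true) (x := fun i => y' i.+1) (y := x') n2) => i j im jm.
  + by move=> ij; apply: yy'; lia.
  + by move=> ij; apply: xx'; lia.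
  + by rewrite adj_sym xy'; lia.
- right; left; exists (fun i => x' (m.-2 - i)), (fun i => y' (m.-2 - i)); split=> i j im jm.
  + by have [->|ij] := eqVneq i j; rewrite ?adj_irr // xx'; lia.
  + by have [->|ij] := eqVneq i j; rewrite ?adj_irr // yy'; lia.
  + by rewrite xy'; lia.
- right; left; exists y', x'; split=> i j im jm.
  + by have [->|ij] := eqVneq i j; rewrite ?adj_irr // yy'; lia.
  + by have [->|ij] := eqVneq i j; rewrite ?adj_irr // xx'; lia.
  + by rewrite adj_sym xy'; lia.
- left; apply: (half_graph_of (eps := false) (x := x') (y := y') n2) => i j im jm.
  + by move=> ij; apply: xx'; lia.
  + by move=> ij; apply: yy'; lia.
  + by rewrite xy'; lia.
Qed.

(* Each step halves [S], hence the exponential bound. *)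
Lemma splitting_sequence (G : sgraph) : prime_graph G -> 2 < #|G| ->
  forall r (S : {set G}), 2 ^ r <= #|S| -> exists s t : nat -> G,
  [/\ forall i, i < r -> s i \in S, forall i, i < r -> t i != s i
    & forall i j, i < j < r -> adj (t i) (s j) = ~~ adj (t i) (s i)].
Proof.
move=> prG G2; elim=> [|r IH] S Sr.
  have /card_gt0P[x _] := ltn_trans (isT : 0 < 2) G2.
  by exists (fun=> x), (fun=> x); split=> // i j; lia.
have /card_gt1P[x [y [xS yS xy]]] : 1 < #|S|.
  by apply: leq_trans Sr; rewrite expnS leq_pmulr // expn_gt0.
(* Otherwise [[set x; y]] would be homogeneous. *)
have [t /and3P[tx ty txy]] : exists t, [&& t != x, t != y & adj t x != adj t y].
  apply/existsP; apply: contraT => /existsPn h; exfalso; apply: (prG [set x; y]).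
  split=> [|v]; first by rewrite cards2 xy.
  rewrite !inE negb_or => /andP[vx vy]; have := h v; rewrite vx vy negbK /= => /eqP vxy.
  by case E: (adj v x); [left|right] => u; rewrite !inE => /orP[]/eqP->; rewrite -?vxy E.
pose S1 := [set u in S | adj t u == adj t x].
pose S0 := [set u in S | adj t u == ~~ adj t x].
suff [u [T [uS tu TS Tr tT]]] : exists u (T : {set G}),
    [/\ u \in S, t != u, T \subset S, 2 ^ r <= #|T| & {in T, forall w, adj t w = ~~ adj t u}].
  have [s' [t' [sT ts sp]]] := IH T Tr.
  exists (fun i => if i is i'.+1 then s' i' else u), (fun i => if i is i'.+1 then t' i' else t).
  split.
  - by case=> // i ir; apply: (subsetP TS); apply: sT.
  - by case=> // i ir; apply: ts.
  - by case=> [|i] [|j] // ij; [apply/tT/sT|apply: sp].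
have ES : #|S| = #|S1| + #|S0|.
  rewrite -(cardsID S1 S); congr (_ + _); apply: eq_card => u; rewrite !inE.
    by case: (u \in S).
  by case: (u \in S) => //=; do 2 case: adj.
(* The larger half is kept. Whichever of [x], [y] lies in the other half becomes the next [s], with
   [t] separating it from all that is kept. *)
have [Tr|Tr] := leqP (2 ^ r) #|S1|.
  exists y, S1; split=> //.
    by apply/subsetP => u; rewrite inE => /andP[].
  by move=> u; rewrite inE => /andP[_ /eqP->]; move: txy; do 2 case: adj.
exists x, S0; split=> //.
- by apply/subsetP => u; rewrite inE => /andP[].
- by move: Sr Tr; rewrite ES expnS; lia.
- by move=> u; rewrite inE => /andP[_ /eqP].
Qed.

(* For [eps = false] an induced matching, for [eps = true] its complement. *)
Definition matching (eps : bool) (m : nat) (G : sgraph) : Prop :=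
  exists x y : nat -> G,
  [/\ forall i, i < m -> x i != y i,
      forall i j, i < m -> j < m -> i != j -> adj (x i) (x j) = eps,
      forall i j, i < m -> j < m -> i != j -> adj (y i) (y j) = eps
    & forall i j, i < m -> j < m -> adj (x i) (y j) = eps (+) (i == j)].

Lemma prime_initial (n m : nat) : 2 < n -> exists N, forall G : sgraph,
  prime_graph G -> N <= #|G| ->
  unavoidable n G \/ threshold m G \/ exists eps, matching eps m G.
Proof.
(* The array has the columns [s] and [t]. The size [n.+2] serves [classify], and [m.+1] allows for
   the index lost in a half split graph. *)
move=> n2; have [r Hr] := array_ramsey 1 1 (maxn n.+2 m.+1).
exists (maxn 3 (2 ^ r)) => G prG; rewrite geq_max => /andP[G2 Gr].
have [s [t [_ ts sp]]] := splitting_sequence prG G2 (S := setT) ltac:(rewrite cardsT; exact: Gr).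
have [f [A [D [_ [finc fr _ HA HD]]]]] :=
  Hr G (fun i p => if p == 0 then s i else t i) (fun=> ord0).
set M := maxn _ _ in finc fr HA HD.
have colA (z : nat -> G) (p : nat) : (forall i, adj (z (f i)) (z (f i)) = false) ->
  (forall i j, i < j < M -> adj (z (f i)) (z (f j)) = A p p) ->
  forall i j, i < M -> j < M -> i != j -> adj (z (f i)) (z (f j)) = A p p.
  move=> _ h i j iM jM; case: ltngtP => // ij _; first by apply: h; lia.
  by rewrite adj_sym; apply: h; lia.
have ss := colA s 0 (fun=> adj_irr _) (fun i j ij => HA i j 0 0 ij isT isT).
have tt := colA t 1 (fun=> adj_irr _) (fun i j ij => HA i j 1 1 ij isT isT).
have lt i j : i < j < M -> adj (s (f i)) (t (f j)) = A 0 1.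
  by move=> ij; exact: (HA i j 0 1 ij isT isT).
have gt i j : i < j < M -> adj (s (f j)) (t (f i)) = A 1 0.
  by move=> ij; rewrite adj_sym; exact: (HA i j 1 0 ij isT isT).
have eq i : i < M -> adj (s (f i)) (t (f i)) = D 0 1.
  by move=> iM; exact: (HD i 0 1 iM isT isT).
(* The splitting property says that [t] treats its own [s] unlike later ones. This excludes the case
   in which both columns are related trivially. *)
have ne : A 1 0 = ~~ D 0 1.
  have M01 : 0 < 1 < M by rewrite /M; lia.
  have M1 : 1 < M by lia.
  have f01 : f 0 < f 1 < r by rewrite finc //= fr.
  by have := sp _ _ f01; rewrite adj_sym (gt 0 1 M01) adj_sym (eq 0 (ltnW M1)).
have nM : n.+1 < M by rewrite /M; lia.
have nt : ~~ ((A 0 1 == D 0 1) && (D 0 1 == A 1 0)).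
  by rewrite ne; case: (D 0 1); rewrite ?andbF.
have [|[[d [a [dd aa da]]]|[h1 h2 h3 h4]]] := classify n2 nM ss tt lt gt eq nt; first by left.
  by right; left; exists d, a; split=> i j im jm; [apply: dd|apply: aa|apply: da];
    rewrite /M in im *; lia.
have mM i : i < m -> i < M by rewrite /M; lia.
right; right; exists (A 0 1), (s \o f), (t \o f); split=> /=.
- by move=> i /mM iM; rewrite eq_sym ts // fr.
- by move=> i j /mM iM /mM jM ij; rewrite ss.
- by move=> i j /mM iM /mM jM ij; rewrite tt.
- move=> i j /mM iM /mM jM; case: (ltngtP i j) => [ij|ij|<-].
  + by rewrite addbF lt // ij.
  + by rewrite addbF gt ?ij // h3.
  + by rewrite addbT eq.
Qed.

(** * Matchings and half split graphs *)

Lemma choose_below (P : Prop) (T : Type) (t0 : T) (Q : nat -> T -> Prop) N :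
  (forall i, i < N -> P \/ exists x, Q i x) ->
  P \/ exists f : nat -> T, forall i, i < N -> Q i (f i).
Proof.
elim: N => [|N IH] h; first by right; exists (fun=> t0).
have [i iN|Pp|[f fQ]] := IH; [by apply: h; lia|by left|].
have [Pp|[x Qx]] := h N (ltnSn N); first by left.
right; exists (fun i => if i == N then x else f i) => i iN.
by case: eqP => [->//|/eqP ne]; apply: fQ; lia.
Qed.

(* Connectedness of a chain whose first two vertices are adjacent; [D] is the adjacency
   within the chain and [f] the adjacency to a fixed vertex. *)
Lemma row_uniform (f : nat -> bool) (D : nat -> nat -> bool) (k : nat) (eps : bool) :
  (forall p q, D p q = D q p) -> D 0 1 = ~~ eps ->
  (forall r p, p.+1 < r < k -> D r p = ~~ D r r.-1) ->
  (forall p q, p < k -> q < k -> D p q = ~~ eps -> f p = f q) ->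
  forall p, p < k -> f p = f 0.
Proof.
move=> Dsym D01 ch unif; elim/ltn_ind; case=> [|[|p]] IH pk //.
  by apply: unif; rewrite 1?Dsym //; lia.
have [h|h] := eqVneq (D p.+2 0) (~~ eps); first by apply: unif => //; lia.
rewrite -(IH p.+1) //; last lia.
apply: unif => //; first lia.
by move: h; rewrite ch //=; case: (D p.+2 p.+1); case: (eps).
Qed.

(** Induction on the column [r]: as long as no outcome appears, distinct rows have adjacency [eps]
    throughout columns up to [r]. At column [k] this is absurd. All its entries equal [z], so [z]
    would have adjacency [eps] to a whole row, although it is mixed on that row. *)
Lemma array_outcome (n M k : nat) (G : sgraph) (eps : bool) (z : G)
    (w : nat -> nat -> G) (A D : nat -> nat -> bool) :
  2 < n -> n.+1 < M -> 1 < k ->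
  (forall r p, p.+1 < r <= k -> D r p = ~~ D r r.-1) ->
  (forall i, i < M -> w i k = z) ->
  (forall i j p q, i < j < M -> p <= k -> q <= k -> adj (w i p) (w j q) = A p q) ->
  (forall i p q, i < M -> p <= k -> q <= k -> adj (w i p) (w i q) = D p q) ->
  A 0 0 = eps -> A 0 1 = eps -> A 1 0 = eps -> A 1 1 = eps -> D 0 1 = ~~ eps ->
  unavoidable n G \/ threshold M.-1 G.
Proof.
move=> n2 nM k1 ch wz HA HD A00 A01 A10 A11 D01.
have M0 : 0 < M by lia.
have Dsym p q : p <= k -> q <= k -> D p q = D q p.
  by move=> pk qk; rewrite -(HD 0 p q) // -(HD 0 q p) // adj_sym.
have Dmixed r b : 1 < r <= k -> exists2 p, p < r & D r p = b.
  move=> rk; have := ch r 0 ltac:(lia).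
  have [<-|h] := eqVneq (D r 0) b; first by exists 0; lia.
  by move=> e; exists r.-1; [lia|move: h; rewrite e; case: (D r r.-1); case: (b)].
suff main r : 1 < r <= k -> (forall p q, p < r -> q < r -> A p q = eps) ->
    (unavoidable n G \/ threshold M.-1 G) \/
    (forall p, p <= r -> A r p = eps /\ A p r = eps).
  have all r : r <= k.+1 ->
      (unavoidable n G \/ threshold M.-1 G) \/ forall p q, p < r -> q < r -> A p q = eps.
    elim: r => [|r IH] rk; first by right.
    have [rle|r1] := leqP r 1.
      right=> -[|[|p]] [|[|q]] //; lia.
    have [//|h] := IH (ltnW rk); first by left.
    have [|h'|h'] := main r _ h; [lia|by left|right=> p q].
    rewrite !ltnS => pr qr; have [h1 h2] := h' _ pr; have [h3 h4] := h' _ qr.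
    have [->|pr'] := eqVneq p r => //; have [->|qr'] := eqVneq q r => //.
    by apply: h; lia.
  have [//|h] := all k.+1 (leqnn _).
  have [p pk Dp] := Dmixed k (~~ eps) ltac:(lia).
  have : A k p = D k p.
    rewrite -(HA 0 1) //; [|lia..]; rewrite -(HD 1) //; [|lia..].
    by rewrite !wz //; lia.
  by rewrite h // ?Dp; [case: (eps)|lia].
move=> rk Aeps.
(* If [f] is not constant, connectedness of the rows gives columns [p], [q] with [D p q = ~~ eps] on
   which [c] differs. The [n] rows starting at [o] then form a subdivided star with centre [c]. *)
have uniform (c : G) (f : nat -> bool) (o : nat) : o <= 1 ->
    (forall i p, i < n -> p < r -> adj c (w (o + i) p) = f p) ->
    unavoidable n G \/ forall p, p < r -> f p = f 0.
  move=> o1 cf.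
  have [|nex] :=
    boolP [exists p : 'I_r, exists q : 'I_r, (D p q == ~~ eps) && (f p == ~~ eps) && (f q == eps)].
    case/existsP=> p /existsP[q /andP[/andP[/eqP Dpq /eqP fp] /eqP fq]]; left.
    have [pr qr] := (ltn_ord p, ltn_ord q).
    have off p' q' i j : p' < r -> q' < r -> i < n -> j < n -> i != j ->
        adj (w (o + i) p') (w (o + j) q') = eps.
      move=> p'r q'r im jm; case: ltngtP => // ij _.
        by rewrite (HA (o + i)) ?Aeps //; lia.
      by rewrite adj_sym (HA (o + j)) ?Aeps //; lia.
    apply: (subdivision_of (eps := eps) (x := fun i => w (o + i) p) (y :=
      fun i => w (o + i) q) (c := c) n2).
    - by move=> i j im jm ij; apply: off.
    - by move=> i j im jm ij; apply: off.
    - move=> i j im jm; have [<-|ij] := eqVneq i j; last by rewrite off // addbF.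
      by rewrite HD ?Dpq ?addbT //; lia.
    - by move=> i im; rewrite cf.
    - by move=> i im; rewrite cf.
  (* [D] is cut off at [r] because [row_uniform] wants symmetry for all indices. *)
  right; apply: (@row_uniform f (fun p q => if (p < r) && (q < r) then D p q else eps) r eps).
  - move=> p q; rewrite andbC; case: ifP => // /andP[qr pr]; apply: Dsym; lia.
  - by rewrite (_ : (0 < r) && (1 < r)) //; lia.
  - move=> r' p pr; have -> : (r' < r) && (p < r) by lia.
    have -> : (r' < r) && (r'.-1 < r) by lia.
    by apply: ch; lia.
  move=> p q pr qr; rewrite pr qr /= => Dpq; apply/eqP/negPn/negP => fpq.
  case/negP: nex; have Dqp : D q p = ~~ eps by rewrite Dsym //; lia.
  have [fp|fp] := eqVneq (f p) eps; apply/existsP.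
    exists (Ordinal qr); apply/existsP; exists (Ordinal pr); rewrite /= Dqp fp !eqxx.
    by move: fpq; rewrite fp; case: (f q) (eps) => -[].
  exists (Ordinal pr); apply/existsP; exists (Ordinal qr); rewrite /= Dpq eqxx.
  by move: fpq fp; case: (f p) (f q) (eps) => -[] [].
(* The centre must lie in a row outside the [n] rows used: row 0 against the later rows for [A r],
   then row [n] against the earlier ones for [A^~ r]. *)
have [|u1|Al] := uniform (w 0 r) (A r) 1 isT; [|by left; left|].
  by move=> i p im pr; rewrite HA //; lia.
have [|u2|Au] := uniform (w n r) (fun p => A p r) 0 isT; [|by left; left|].
  by move=> i p im pr; rewrite adj_sym HA //; lia.
have col p : p <= k -> forall i j, i < M -> j < M -> i != j -> adj (w i p) (w j p) = A p p.
  move=> pk i j im jm; case: ltngtP => // ij _; first by rewrite (HA i j) //; lia.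
  by rewrite adj_sym (HA j i) //; lia.
have cls p : p < r -> ~~ ((A p r == D p r) && (D p r == A r p)) ->
    (unavoidable n G \/ threshold M.-1 G) \/ [/\ eps = A p r, A r r = A p r & A r p = A p r].
  move=> pr nt.
  have [|||||u|[t|[h1 h2 h3 _]]] :=
    @classify n M G (w^~ p) (w^~ r) (A p p) (A r r) (A p r) (D p r) (A r p) n2 nM _ _ _ _ _ nt.
  - by apply: col; lia.
  - by apply: col; lia.
  - by move=> i j ij; apply: HA; lia.
  - by move=> i j ij; rewrite adj_sym; apply: HA; lia.
  - by move=> i im; apply: HD; lia.
  - by left; left.
  - by left; right.
  - by right; split; rewrite // -h1 Aeps.
(* Unequal values make columns 0 and [r] a half graph. Equal ones are matched against a column [p]
   that [r] sees differently within its row, giving a matching or co-matching. *)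
have [ab|ab] := eqVneq (A r 0) (A 0 r); last first.
  have [||//|[_ _ h]] := cls 0; [lia| |by left|by rewrite h eqxx in ab].
  by apply: contra ab => /andP[/eqP-> /eqP->].
have [p pr Dp] := Dmixed r (~~ A r 0) rk.
have [//||//|[h1 h2 h3]] := cls p; [|by left|right=> q].
  by rewrite Al // Au // -ab Dsym ?Dp; [case: (A r 0)|lia..].
rewrite leq_eqVlt => /orP[/eqP->|qr]; first by rewrite h2 -h1.
by rewrite Al // Au // -ab -(Al p) // h3 -h1.
Qed.

(** The pair with index [N] is set aside, and its end [x N] is the common endpoint of the chains.
    Chain lengths are at most [n], so they can be made equal through [kap]. *)
Lemma matching_outcome (n m : nat) : 2 < n -> exists N, forall G : sgraph,
  prime_graph G -> forall eps, matching eps N G -> unavoidable n G \/ threshold m G.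
Proof.
move=> n2; pose M := maxn n.+2 m.+1.
have [N HN] := array_ramsey n n.+1 M; exists N.+1 => G prG eps [x [y [xy xx yy xyE]]].
pose Q i (vl : (nat -> G) * nat) :=
  [/\ is_chain vl.2.+1 vl.1, vl.1 0 = x i, vl.1 1 = y i, vl.1 vl.2 = x N & 1 < vl.2 <= n].
have : unavoidable n G \/ exists f, forall i, i < N -> Q i (f i).
  (* Chains are known to exist only row by row; finite choice collects them into one array. *)
  apply: (choose_below ((fun=> x N), 0)) => i iN.
  have xyN : adj (x N) (y N) = ~~ eps by rewrite xyE // eqxx addbT.
  have xyi : adj (x i) (y N) = eps by rewrite xyE ?(ltn_eqF iN) ?addbF //; lia.
  have yyi : adj (y i) (y N) = eps by rewrite yy //; lia.
  have xNx : x N != x i by apply/eqP => h; move: xyN; rewrite h xyi; case: (eps).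
  have xNy : x N != y i by apply/eqP => h; move: xyN; rewrite h yyi; case: (eps).
  have [|u|[v [l]]] := chain_or_unavoidable n2 prG (xy i _) xNx xNy; first lia.
    by left.
  by right; exists (v, l).
case=> [u|[f fQ]]; first by left.
have [s [A [D [k [sinc sN kap HA HD]]]]] := HN G (fun i => (f i).1) (fun i => inord (f i).2).
have fk i : i < M -> (f (s i)).2 = k.
  move=> iM; rewrite -(kap i iM) inordK //.
  by have [_ _ _ _ /andP[_]] := fQ _ (sN i iM).
have nM : n.+1 < M by rewrite /M; lia.
have M0 : 0 < M by lia.
have M1 : 0 < 1 < M by lia.
have Q_ i : i < M -> Q (s i) (f (s i)) by move=> iM; apply/fQ/sN.
have kn : k <= n by rewrite -ltnS.
have k1 : 1 < k by have [_ _ _ _] := Q_ 0 M0; rewrite (fk 0 M0) => /andP[].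
have st i : i < M -> ((f (s i)).1 0 = x (s i)) * ((f (s i)).1 1 = y (s i)).
  by case/Q_.
have s01 : (s 0 == s 1) = false by rewrite ltn_eqF // sinc.
have [sN0 sN1] : s 0 < N.+1 /\ s 1 < N.+1.
  by split; apply/ltnW/sN; lia.
have A_ p q : p <= 1 -> q <= 1 -> A p q = adj ((f (s 0)).1 p) ((f (s 1)).1 q).
  by move=> p1 q1; rewrite (HA 0 1) //; lia.
have [|||||||||u|[d [a [dd aa da]]]] := @array_outcome n M k G eps (x N)
    (fun i => (f (s i)).1) A D n2 nM k1.
- move=> r p pr; have [[_ ch] _ _ _ _] := Q_ 0 M0; rewrite (fk 0 M0) in ch.
  by rewrite -!(HD 0) //; [apply: ch|..]; lia.
- by move=> i iM; have [_ _ _] := Q_ i iM; rewrite fk.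
- by move=> i j p q ij pk qk; apply: HA; lia.
- by move=> i p q iM pk qk; apply: HD; lia.
- by rewrite A_ // !st // xx ?s01.
- by rewrite A_ // !st // xyE // s01 addbF.
- by rewrite A_ // !st // adj_sym xyE // eq_sym s01 addbF.
- by rewrite A_ // !st // yy ?s01.
- by rewrite -(HD 0) ?st ?xyE ?eqxx ?addbT //; lia.
- by left.
right; exists d, a; split=> i j im jm; [apply: dd|apply: aa|apply: da]; rewrite /M; lia.
Qed.

Lemma threshold_unavoidable (n : nat) : 2 < n -> exists N, forall G : sgraph,
  prime_graph G -> threshold N G -> unavoidable n G.
Proof.
(* Labels belong to single indices, so the last of the [n.+2] indices only serves to form pairs. The
   indices 0 and [N.+1] of the half split graph are reserved for the ends of the chain. *)
move=> n2; have [N HN] := ramsey {ffun 'I_n.+1 -> bool * bool} n.+2.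
exists N.+2 => G prG [d [a [dd aa da]]].
have dN0 : d 0 != d N.+1 by apply: contraTneq (dd 0 N.+1 isT (leqnn _)) => ->; rewrite adj_irr.
have da0 : d 0 != a N.+1.
  by apply/eqP => h; have := aa N.+1 N.+1 (leqnn _) (leqnn _); have := da 0 N.+1 isT (leqnn _);
     rewrite -{1 2}h adj_irr.
have daN : d N.+1 != a N.+1.
  by apply/eqP => h; have := da N.+1 N.+1 (leqnn _) (leqnn _); rewrite h adj_irr leqnn.
have [//|[v [l [[_ ch] v0 v1 vl /andP[l1 ln]]]]] := chain_or_unavoidable n2 prG daN dN0 da0.
pose lab i : {ffun 'I_n.+1 -> bool * bool} :=
  [ffun j : 'I_n.+1 => (adj (v j) (d i.+1), adj (v j) (a i.+1))].
have [s [c [sinc sN col]]] := HN (fun i _ => lab i).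
have labc i j : i <= n -> j <= n ->
    (adj (v j) (d (s i).+1), adj (v j) (a (s i).+1)) = c (inord j).
  by move=> i_n jn; rewrite -(col i n.+1) ?ffunE ?inordK //; lia.
have sle i j : i <= n -> j <= n -> (s i <= s j) = (i <= j).
  move=> i_n jn; case: (ltngtP i j) => [ij|ji|->]; last by rewrite leqnn.
    by apply/ltnW/sinc; lia.
  by apply/negbTE; rewrite -ltnNge; apply: sinc; lia.
pose d' i := d (s i).+1; pose a' i := a (s i).+1.
have sN' i : i <= n -> (s i).+1 < N.+2 by move=> i_n; have := sN i; lia.
have dd' i j : i <= n -> j <= n -> i != j -> adj (d' i) (d' j) = true.
  move=> i_n jn ij; rewrite dd ?sN' // eqSS eqn_leq !sle //; lia.
have aa' i j : i <= n -> j <= n -> adj (a' i) (a' j) = false.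
  by move=> i_n jn; rewrite aa ?sN'.
have da' i j : i <= n -> j <= n -> adj (d' i) (a' j) = (i <= j).
  by move=> i_n jn; rewrite da ?sN' // ltnS sle.
(* The label of a vertex attaching like a last one is [(true, false)]. The final vertex [d 0] is
   adjacent to every [a'], so it does not have this label. *)
have exk : exists k, (k <= l) && (c (inord k) != (true, false)).
  exists l; rewrite leqnn -(labc 0) // vl /= -/(a' 0).
  by rewrite (da 0 (s 0).+1) ?sN' // xpair_eqE andbF.
case: (ex_minnP exk) => k /andP[kl ck] mink.
have kn := leq_trans kl ln.
have low j i : j < k -> i <= n -> adj (v j) (d' i) = true /\ adj (v j) (a' i) = false.
  move=> jk i_n; have : c (inord j) == (true, false).
    by apply/negPn/negP => h; have := mink j; rewrite h andbT; lia.
  by rewrite -(labc i) //; [move/eqP => [-> ->]|lia].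
have k1 : 1 < k.
  rewrite ltnNge; apply: contra ck => k1; rewrite -(labc 0) //.
  have s0 : s 0 < N by apply: sN.
  case: k k1 {mink kl kn low exk} => [|[|//]] _; rewrite ?v0 ?v1.
    by rewrite dd ?da ?xpair_eqE ?eqb_id ?eqbF_neg; lia.
  by rewrite adj_sym da ?aa ?xpair_eqE ?eqb_id ?eqbF_neg; lia.
(* Since [k > 1], the chain condition makes [v k] mixed on the earlier vertices, all of which attach
   like last vertices. *)
have mixed b : exists2 j, j < k & adj (v k) (v j) = b.
  have e := ch k 0 k1 kl.
  have [<-|h] := eqVneq (adj (v k) (v 0)) b; first by exists 0; lia.
  by exists k.-1; [lia|move: h; rewrite e; case: adj; case: (b)].
case E: (c (inord k)) ck => [al be] ck.
have vd i : i <= n -> adj (v k) (d' i) = al.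
  by move=> i_n; have := labc i k i_n kn; rewrite E => -[].
have va i : i <= n -> adj (v k) (a' i) = be.
  by move=> i_n; have := labc i k i_n kn; rewrite E => -[].
case: al be ck {E} vd va => -[] // _ vd va.
(* The three remaining labels of [v k]. When it treats [d'] and [a'] alike, an earlier [v j] that it
   treats differently takes the place of the last [x], the one vertex distinguished by the added
   one. *)
- have [j jk vj] := mixed false.
  apply: (half_split_star_of (eps := true) (c := v k) (y := a')
    (x := fun i => if i.+1 == n then v j else d' i.+1) n2).
  + move=> p q pn qn pq; case: eqP => pe; case: eqP => qe; first by lia.
    * by have [] := low j q.+1 jk qn.
    * by rewrite adj_sym; have [] := low j p.+1 jk pn.
    * by apply: dd'.
  + by move=> p q pn qn _; apply: aa'; lia.
  + move=> p q pn qn; case: eqP => pe.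
      by have [|_ ->] := low j q jk; lia.
    by rewrite da'; lia.
  + by move=> p pn; case: eqP => pe; [rewrite vj|rewrite vd].
  + by move=> p pn; apply: va; lia.
- apply: (half_split_I_of (eps := false) (c := v k) (x := a') (y := d') n2).
  + by move=> p q pn qn _; apply: aa'; lia.
  + by move=> p q pn qn pq; apply: dd'; lia.
  + by move=> p q pn qn; rewrite adj_sym da'; lia.
  + by move=> p pn; apply: va; lia.
  + by move=> p pn; apply: vd; lia.
- have [j jk vj] := mixed true.
  apply: (half_split_star_of (eps := false) (c := v k) (y := d')
    (x := fun i => if i.+1 == n then v j else a' i) n2).
  + move=> p q pn qn pq; case: eqP => pe; case: eqP => qe; first by lia.
    * by have [|_] := low j q jk; lia.
    * by rewrite adj_sym; have [|_] := low j p jk; lia.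
    * by apply: aa'; lia.
  + by move=> p q pn qn pq; apply: dd'; lia.
  + move=> p q pn qn; case: eqP => pe.
      by have [|->] := low j q jk; lia.
    by rewrite adj_sym da'; lia.
  + by move=> p pn; case: eqP => pe; [rewrite vj|rewrite va; lia].
  + by move=> p pn; apply: vd; lia.
Qed.

Theorem theorem1p2 (n : nat) (hn : 3 <= n) :
  exists N : nat, forall G : sgraph, prime_graph G -> N <= #|G| ->
    contains_or_compl G (subdivision (complete_bipartite 1 n)) \/
    contains_or_compl G (line_graph (complete_bipartite 2 n)) \/
    contains_or_compl G (thin_spider n) \/
    contains_or_compl G (half_graph n) \/
    contains_or_compl G (half_split_I n) \/
    contains_or_compl G (half_split_star n) \/
    (exists H : sgraph,
      [/\ prime_graph H, induced_by_chain n H & contains_or_compl G H]).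
Proof.
have [Nt Ht] := threshold_unavoidable hn.
have [Nm Hm] := matching_outcome Nt hn.
(* The maximum serves both outcomes, since half split graphs and matchings can be truncated. *)
have [N HN] := prime_initial (maxn Nt Nm) hn.
exists N => G prG GN; rewrite -/(unavoidable n G).
have thr m : Nt <= m -> threshold m G -> unavoidable n G.
  move=> tm [d [a [dd aa da]]]; apply: Ht => //.
  by exists d, a; split=> i j it jt; [apply: dd|apply: aa|apply: da]; lia.
have [//|[t|[eps [x [y [xy xx yy xyE]]]]]] := HN G prG GN.
  by apply: thr t; lia.
have [|//|t] := Hm G prG eps; last exact: thr t.
by exists x, y; split=> [i it|i j it jt|i j it jt|i j it jt];
  [apply: xy|apply: xx|apply: yy|apply: xyE]; lia.
Qed.
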